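(* Let $f_1,\dots,f_n:\mathbb{R}^d\to\mathbb{R}$ be of class $C^2$ with $\nabla^2f_i(w)\succ0$ for every $w\in\mathbb{R}^d$ and every $i$. Let $\pi\in(0,1)$ and let $\gamma\in(0,1]$ be a step size. Then the SAN algorithm with parameters $\pi,\gamma$ is equivalent to the Variable Metric Sketched Newton Raphson method with step size $\gamma$ applied to the function-splitting map $F$, where at each iteration $(\mathbf{S}_k,\mathbf{W}_k)$ is sampled from $\mathcal{D}^{\mathrm{SAN}}_{x^k}$ (all defined in the context). That is, started from the same $x^0$ and with the same random choices (branch and index $j$), both algorithms produce the same iterates $x^k=[w^k;\alpha_1^k;\dots;\alpha_n^k]$.
   Context: Let $p=(n+1)d$ and $x=[w;\alpha_1;\dots;\alpha_n]\in\mathbb{R}^p$, $w,\alpha_i\in\mathbb{R}^d$. Function-splitting map: $F(x)=[\frac1n\sum_i\alpha_i;\nabla f_1(w)-\alpha_1;\dots;\nabla f_n(w)-\alpha_n]\in\mathbb{R}^p$; $\nabla F(x)\in\mathbb{R}^{p\times p}$ is the transpose of the usual Jacobian; $\|v\|^2_{\mathbf{M}}=\langle\mathbf{M}v,v\rangle$. SAN: at each iteration $k$, with probability $\pi$: $\alpha_i^{k+1}=\alpha_i^k-\frac\gamma n\sum_{j=1}^n\alpha_j^k$ for all $i$, and $w^{k+1}=w^k$. Otherwise (with probability $1-\pi$): sample $j\in\{1,\dots,n\}$ uniformly, set $d^k=-(\mathbf{I}_d+\nabla^2f_j(w^k))^{-1}(\nabla f_j(w^k)-\alpha_j^k)$,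 $w^{k+1}=w^k+\gamma d^k$, $\alpha_j^{k+1}=\alpha_j^k-\gamma d^k$, $\alpha_i^{k+1}=\alpha_i^k$ for $i\neq j$. Variable Metric Sketched Newton Raphson method: given $x^k$ and $(\mathbf{S}_k,\mathbf{W}_k)$, $$\bar x^{k+1}=\mathrm{argmin}_{x}\ \|x-x^k\|^2_{\mathbf{W}_k}\ \text{ subject to }\ \mathbf{S}_k^\top\nabla F(x^k)^\top(x-x^k)=-\mathbf{S}_k^\top F(x^k),\qquad x^{k+1}=(1-\gamma)x^k+\gamma\bar x^{k+1}.$$ Distribution: let $\mathbf{E}_i\in\mathbb{R}^{p\times d}$ ($i=1,\dots,n+1$) have $\mathbf{I}_d$ in block row $i$ and zeros elsewhere. $(\mathbf{S},\mathbf{W})\sim\mathcal{D}_x^{\mathrm{SAN}}$ means: with probability $\pi$, $\mathbf{S}=\mathbf{E}_1$, $\mathbf{W}=\mathbf{I}_p$; with probability $1-\pi$, sample $j\in\{1,\dots,n\}$ uniformly and set $\mathbf{S}=\mathbf{E}_{j+1}$, $\mathbf{W}=\mathrm{Diag}(\nabla^2f_j(w),\mathbf{I}_d,\dots,\mathbf{I}_d)$ (block diagonal). *)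

(* Defs.v *)
(* Vectors of R^d are column vectors 'cV[R]_d. *)
From HB Require Import structures.
From mathcomp Require Import all_boot all_order all_algebra.
From mathcomp Require Import all_classical all_reals all_analysis.

Set Implicit Arguments.
Unset Strict Implicit.
Unset Printing Implicit Defensive.

Import Order.TTheory GRing.Theory Num.Theory.
Import numFieldNormedType.Exports.
Local Open Scope classical_set_scope.
Local Open Scope ring_scope.

Section Calculus.
Context {R : realType}.

Definition partial {d} (i : 'I_d) (g : 'cV[R]_d -> R) (x : 'cV[R]_d) : R :=
  'D_(delta_mx i 0) g x.

Definition C1 {d} (g : 'cV[R]_d -> R) : Prop :=
  forall i, (forall x, derivable g x (delta_mx i 0)) /\
            continuous (partial i g).

Definition C2 {d} (g : 'cV[R]_d -> R) : Prop :=
  C1 g /\ forall i, C1 (partial i g).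

Definition grad {d} (g : 'cV[R]_d -> R) (x : 'cV[R]_d) : 'cV[R]_d :=
  \col_i partial i g x.

(* Transpose of the usual Jacobian: entry (i, j) is the i-th partial
   derivative of the j-th component of G. *)
Definition nabla {d m} (G : 'cV[R]_d -> 'cV[R]_m) (x : 'cV[R]_d) : 'M[R]_(d, m) :=
  \matrix_(i, j) partial i (fun y => G y j 0) x.

Definition hess {d} (g : 'cV[R]_d -> R) (x : 'cV[R]_d) : 'M[R]_d :=
  nabla (grad g) x.

Definition dot {d} (u v : 'cV[R]_d) : R := (u^T *m v) 0 0.

Definition sqnorm {d} (M : 'M[R]_d) (v : 'cV[R]_d) : R := dot (M *m v) v.

(* Symmetry is not required: for Hessians of C2 functions it is a theorem. *)
Definition posdef {d} (M : 'M[R]_d) : Prop := forall v, v != 0 -> 0 < sqnorm M v.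

Definition argmin {V : Type} (A : set V) (phi : V -> R) : set V :=
  [set x | A x /\ forall y, A y -> phi x <= phi y].

End Calculus.

Section VariableMetricSketchedNewtonRaphson.
Context {R : realType} {p m : nat}.
Implicit Types (F : 'cV[R]_p -> 'cV[R]_p) (SW : 'M[R]_(p, m) * 'M[R]_p).

(* "xbar = argmin" is read as: the set of minimizers is exactly {xbar}. *)
Definition vmsnr_step F (gamma : R) SW (x x' : 'cV[R]_p) : Prop :=
  let: (Sk, Wk) := SW in
  exists xbar : 'cV[R]_p,
    argmin [set y | Sk^T *m (nabla F x)^T *m (y - x) = - (Sk^T *m F x)]
           (fun y => sqnorm Wk (y - x)) = [set xbar]
    /\ x' = (1 - gamma) *: x + gamma *: xbar.

Definition vmsnr_run F (gamma : R) (x0 : 'cV[R]_p)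
    (X : nat -> 'cV[R]_p) (SW : nat -> 'M[R]_(p, m) * 'M[R]_p) : Prop :=
  X 0%N = x0 /\ forall k, vmsnr_step F gamma (SW k) (X k) (X k.+1).

(* At each iteration k, conditionally on the history X_0, ..., X_k,
   SW_0, ..., SW_(k-1), the pair SW_k has law D (X_k). Conditioning is
   elementary (on the values of the history), which is adequate when, as
   below, x0 is deterministic and every D x is finitely supported, so that
   each history takes finitely many values. *)
Definition sampled_from d (T : measurableType d) (P : probability T R)
    (D : 'cV[R]_p -> set ('M[R]_(p, m) * 'M[R]_p) -> R)
    (X : nat -> T -> 'cV[R]_p) (SW : nat -> T -> 'M[R]_(p, m) * 'M[R]_p) : Prop :=
  forall (k : nat) (x : nat -> 'cV[R]_p) (s : nat -> 'M[R]_(p, m) * 'M[R]_p)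
         (A : set ('M[R]_(p, m) * 'M[R]_p)),
    let H := [set t | (forall i, (i <= k)%N -> X i t = x i) /\
                      (forall i, (i < k)%N -> SW i t = s i)] in
    [/\ measurable H, measurable (H `&` SW k @^-1` A) &
        P (H `&` SW k @^-1` A) = (P H * (D (x k) A)%:E)%E].

End VariableMetricSketchedNewtonRaphson.

(* (n+1)d, in the form used by block matrices (see [pdimE]). *)
Notation pdim n d := (\sum_(i < n.+1) d)%N.

Lemma pdimE n d : pdim n d = (n.+1 * d)%N.
Proof. by rewrite sum_nat_const card_ord. Qed.

Section SAN.
Context {R : realType} {n d : nat}.
Implicit Types (f : 'I_n -> 'cV[R]_d -> R) (x : 'cV[R]_(pdim n d)).

(* stack w a is [w; a_1; ...; a_n]: block 0 is w, block [lift ord0 i] is a_i. *)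
Definition stack (w : 'cV[R]_d) (a : 'I_n -> 'cV[R]_d) : 'cV[R]_(pdim n d) :=
  \mxcol_(k < n.+1) (if unlift ord0 k is Some i then a i else w).

Definition wblock x : 'cV[R]_d := submxcol x ord0.
Definition ablock x (i : 'I_n) : 'cV[R]_d := submxcol x (lift ord0 i).

Definition splitting f x : 'cV[R]_(pdim n d) :=
  stack (n%:R^-1 *: \sum_i ablock x i)
        (fun i => grad (f i) (wblock x) - ablock x i).

(* The random choice made at one iteration: [None] is the averaging branch,
   [Some j] is the other branch with sampled index j. *)
Definition choice_prob (pi : R) (c : option 'I_n) : R :=
  if c is Some _ then (1 - pi) * n%:R^-1 else pi.

(* The choices (xi k)_k are independent with common law [choice_prob pi]. *)
Definition san_choices (pi : R) dT (T : measurableType dT) (P : probability T R)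
    (xi : nat -> T -> option 'I_n) : Prop :=
  (forall k c, measurable (xi k @^-1` [set c])) /\
  (forall (J : seq nat) (c : nat -> option 'I_n), uniq J ->
     P (\bigcap_(k in [set` J]) (xi k @^-1` [set c k])) =
     (\prod_(k <- J) choice_prob pi (c k))%:E).

Definition san_step f (gamma : R) (c : option 'I_n) x : 'cV[R]_(pdim n d) :=
  let w := wblock x in
  let a := ablock x in
  if c is Some j then
    let dir := - (invmx (1%:M + hess (f j) w) *m (grad (f j) w - a j)) in
    stack (w + gamma *: dir)
          (fun i => if i == j then a j - gamma *: dir else a i)
  else
    stack w (fun i => a i - (gamma / n%:R) *: \sum_j a j).

Fixpoint san f (gamma : R) x0 (c : nat -> option 'I_n) (k : nat) :
    'cV[R]_(pdim n d) :=
  if k is k'.+1 then san_step f gamma (c k') (san f gamma x0 c k') else x0.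

Definition blockE (i : 'I_n.+1) : 'M[R]_(pdim n d, d) :=
  \mxcol_(k < n.+1) (if k == i then 1%:M else 0 : 'M[R]_d).

Definition san_metric f (j : 'I_n) (w : 'cV[R]_d) : 'M[R]_(pdim n d) :=
  \mxdiag_(k < n.+1) (if k == ord0 then hess (f j) w else 1%:M).

Definition san_sketch f x (c : option 'I_n) :
    'M[R]_(pdim n d, d) * 'M[R]_(pdim n d) :=
  if c is Some j then (blockE (lift ord0 j), san_metric f j (wblock x))
  else (blockE ord0, 1%:M).

(* The law of (S, W), as a function of sets of pairs (S, W). *)
Definition D_SAN (pi : R) f x
    (A : set ('M[R]_(pdim n d, d) * 'M[R]_(pdim n d))) : R :=
  pi * \1_A (san_sketch f x None)
  + (1 - pi) * (n%:R^-1 * \sum_(j < n) \1_A (san_sketch f x (Some j))).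

End SAN.

(* Main.v *)
(* For each branch c, the constraint and the metric define a strictly convex
   quadratic problem in the increment u = y - x, and the SAN increment [san_dir]
   satisfies its first-order conditions: it is feasible and W-orthogonal to the
   kernel of the constraint, so it is the unique minimizer.  In branch j the
   constraint reads H u_w - u_j = -r, with H the Hessian of f_j at w and r the
   residual grad f_j(w) - alpha_j; orthogonality there needs H to be symmetric,
   whence Schwarz's theorem for functions with continuous second partials.

   For the sampling law, X_0, ..., X_k only depend on the first k choices, so a
   history event is a finite disjoint union of cylinders, and independence makes
   each of them factor through the law of the k-th choice. *)
Require Import Defs.
From HB Require Import structures.
From mathcomp Require Import all_boot all_order all_algebra.
From mathcomp Require Import all_classical all_reals all_analysis.
From mathcomp Require Import ring.
Import Order.TTheory GRing.Theory Num.Theory.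
Import numFieldNormedType.Exports.
Local Open Scope classical_set_scope.
Local Open Scope ring_scope.

Set Implicit Arguments.
Unset Strict Implicit.

(** * Symmetry of mixed directional derivatives *)

Lemma is_derive_line (R : realType) (V : normedModType R) (g : V -> R)
    (u x : V) (t : R) :
  (forall y, derivable g y u) ->
  is_derive t 1 (fun s : R => g (s *: u + x)) ('D_u g (t *: u + x)).
Proof.
move=> gu.
(* The difference quotients agree for every [h], so derivability and the value of the derivative
   transfer together. *)
have E : (fun h : R => h^-1 *: (((fun s : R => g (s *: u + x)) \o shift t) (h *: 1)
            - g (t *: u + x)))
       = (fun h : R => h^-1 *: ((g \o shift (t *: u + x)) (h *: u)
            - g (t *: u + x))).
  by apply/funext => h /=; rewrite [h *: 1]mulr1 scalerDl addrA.
by split; rewrite ?/derivable ?/derive E //; exact: gu.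
Qed.

Lemma MVT_line (R : realType) (V : normedModType R) (g : V -> R)
    (v x : V) (t : R) :
  (forall y, derivable g y v) -> 0 < t ->
  exists2 b, 0 < b < t & g (t *: v + x) - g x = 'D_v g (b *: v + x) * t.
Proof.
move=> gv t0; pose psi (r : R) := g (r *: v + x).
have psi' (r : R) : is_derive r 1 psi ('D_v g (r *: v + x)) by exact: is_derive_line.
have [b b0t] : exists2 b, b \in `]0, t[ & psi t - psi 0 = 'D_v g (b *: v + x) * (t - 0).
  apply: MVT t0 (fun r _ => psi' r) _.
  by apply: derivable_within_continuous => r _; case: (psi' r).
by move: b0t; rewrite in_itv /psi scale0r add0r subr0; exists b.
Qed.

(** Two mean value theorems: along [u] for the difference of [g] on two parallel lines, then along
    [v] for ['D_u g]. *)
Lemma second_difference (R : realType) (V : normedModType R) (g : V -> R)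
    (u v x : V) (s t : R) :
  (forall y, derivable g y u) -> (forall y, derivable ('D_u g) y v) ->
  0 < s -> 0 < t ->
  exists a b, [/\ 0 < a < s, 0 < b < t &
    g (s *: u + (t *: v + x)) - g (s *: u + x) - (g (t *: v + x) - g x)
    = 'D_v ('D_u g) (a *: u + (b *: v + x)) * t * s].
Proof.
move=> gu guv s0 t0.
pose phi (r : R) := g (r *: u + (t *: v + x)) - g (r *: u + x).
pose dphi (r : R) := 'D_u g (r *: u + (t *: v + x)) - 'D_u g (r *: u + x).
have phi' (r : R) : is_derive r 1 phi (dphi r).
  by apply: is_deriveB; apply: is_derive_line.
have [a] : exists2 a, a \in `]0, s[ & phi s - phi 0 = dphi a * (s - 0).
  apply: MVT s0 (fun r _ => phi' r) _.
  by apply: derivable_within_continuous => r _; case: (phi' r).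
rewrite in_itv /= => a0s; rewrite /phi /dphi !scale0r !add0r subr0 => ->.
have [b b0t E] := MVT_line (a *: u + x) guv t0.
by exists a, b; split => //; rewrite addrCA E addrCA.
Qed.

(** Turns continuity at [x] into a bound on the two parameters, the form that fits the intermediate
    points of [second_difference]. *)
Lemma near_plane (R : realType) (V : normedModType R) (h : V -> R)
    (u v x : V) (e : R) :
  {for x, continuous h} -> 0 < e ->
  exists2 r : R, 0 < r & forall a b, 0 < a < r -> 0 < b < r ->
    `|h (a *: u + (b *: v + x)) - h x| < e.
Proof.
move=> ch e0.
have cl : {for ((0, 0) : R * R),
    continuous (fun ab : R * R => ab.1 *: u + (ab.2 *: v + x))}.
  apply: cvgD; first by apply: cvgZr_tmp; exact: cvg_fst.
  by apply: cvgD; [apply: cvgZr_tmp; exact: cvg_snd | exact: cvg_cst].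
have ce : {for ((0, 0) : R * R),
    continuous (fun ab : R * R => h (ab.1 *: u + (ab.2 *: v + x)))}.
  apply: (@continuous_comp _ _ _
    (fun ab : R * R => ab.1 *: u + (ab.2 *: v + x)) h) => //=.
  by rewrite !scale0r !add0r.
have := ce; move=> /cvgrPdist_lt/(_ e e0)/nbhs_ballP[r /= r0 hr].
exists r => // a b /andP[a0 ar] /andP[b0 br].
have := hr (a, b); rewrite /= !scale0r !add0r distrC; apply.
by split; rewrite /= /ball /= sub0r normrN gtr0_norm.
Qed.

(** The second difference over a small square of side [s] is [s * s] times either mixed derivative
    at some point near [x]; by continuity, one common value is close to both derivatives at [x]. *)
Lemma derive_schwarz (R : realType) (V : normedModType R) (g : V -> R)
    (u v x : V) :
  (forall y, derivable g y u) -> (forall y, derivable g y v) ->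
  (forall y, derivable ('D_u g) y v) -> (forall y, derivable ('D_v g) y u) ->
  {for x, continuous ('D_v ('D_u g))} -> {for x, continuous ('D_u ('D_v g))} ->
  'D_v ('D_u g) x = 'D_u ('D_v g) x.
Proof.
move=> gu gv guv gvu cuv cvu.
suff approx e : 0 < e -> exists2 z, `|z - 'D_v ('D_u g) x| < e &
                                    `|z - 'D_u ('D_v g) x| < e.
  move: ('D_v ('D_u g) x) ('D_u ('D_v g) x) approx => p q approx.
  apply/eqP; rewrite -subr_eq0 -normr_le0 leNgt; apply/negP => d0.
  (* With half the distance of [p] and [q] as tolerance, the triangle inequality is contradicted. *)
  have [z zp zq] := approx _ (divr_gt0 d0 (ltr0Sn _ 1)).
  have := ler_normD (p - z) (z - q); rewrite addrA subrK (distrC p z) => h.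
  by have := le_lt_trans h (ltrD zp zq); rewrite -splitr ltxx.
move=> e0.
have [r r0 hr] := near_plane u v cuv e0.
have [r' r'0 hr'] := near_plane v u cvu e0.
have [s s0 [sr sr']] : exists2 s, 0 < s & s <= r /\ s <= r'.
  by exists (Num.min r r'); rewrite ?lt_min ?r0 // !ge_min !lexx orbT.
have small c l : s <= l -> 0 < c < s -> 0 < c < l.
  by move=> sl /andP[-> cs]; exact: lt_le_trans cs sl.
have [a [b [a0s b0s E]]] := second_difference x gu guv s0 s0.
have [b' [a' [b'0s a'0s E']]] := second_difference x gv gvu s0 s0.
exists ('D_v ('D_u g) (a *: u + (b *: v + x))).
  exact: hr (small _ _ sr a0s) (small _ _ sr b0s).
suff -> : 'D_v ('D_u g) (a *: u + (b *: v + x)) =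
          'D_u ('D_v g) (b' *: v + (a' *: u + x)).
  exact: hr' (small _ _ sr' b'0s) (small _ _ sr' a'0s).
(* The second difference is symmetric in [u] and [v], so the two expressions for it agree once
   multiplied by [s] twice. *)
apply: (mulIf (lt0r_neq0 s0)); apply: (mulIf (lt0r_neq0 s0)).
rewrite [s *: v + (_ + _)]addrCA in E'.
have swap (p q y z : R) : p - q - (y - z) = p - y - (q - z) by ring.
exact: etrans (esym E) (etrans (swap _ _ _ _) E').
Qed.

Lemma tr_hess (R : realType) (d : nat) (g : 'cV[R]_d -> R) (x : 'cV[R]_d) :
  C2 g -> (hess g x)^T = hess g x.
Proof.
move=> [g1 g2]; apply/matrixP => i j; rewrite !mxE /partial.
have E l : (fun y => (grad g y) l 0) = 'D_(delta_mx l 0) g.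
  by apply/funext => y; rewrite mxE.
rewrite (E i) (E j); apply: derive_schwarz.
- exact: (g1 i).1.
- exact: (g1 j).1.
- exact: (g2 i j).1.
- exact: (g2 j i).1.
- exact: (g2 i j).2.
- exact: (g2 j i).2.
Qed.

(** * Inner products and quadratic minimization under linear constraints *)

Section Quadratic.
Context {R : realType} {p : nat}.
Implicit Types (u v w x y : 'cV[R]_p) (W : 'M[R]_p).

Lemma dotC u v : dot u v = dot v u.
Proof. by rewrite /dot !mxE; apply: eq_bigr => i _; rewrite !mxE mulrC. Qed.

Lemma dotDl u v w : dot (u + v) w = dot u w + dot v w.
Proof. by rewrite /dot linearD mulmxDl mxE. Qed.

Lemma dotDr u v w : dot u (v + w) = dot u v + dot u w.
Proof. by rewrite /dot mulmxDr mxE. Qed.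

Lemma dotNl u v : dot (- u) v = - dot u v.
Proof. by rewrite /dot linearN mulNmx mxE. Qed.

Lemma dot0l v : dot 0 v = 0.
Proof. by rewrite /dot trmx0 mul0mx mxE. Qed.

Lemma dot0r v : dot v 0 = 0.
Proof. by rewrite dotC dot0l. Qed.

Lemma dot_sumr (I : finType) u (v : I -> 'cV[R]_p) :
  dot u (\sum_i v i) = \sum_i dot u (v i).
Proof. by rewrite /dot mulmx_sumr summxE. Qed.

Lemma dot_mulmxl W u v : dot (W *m u) v = dot u (W^T *m v).
Proof. by rewrite /dot trmx_mul mulmxA. Qed.

Lemma dot_ge0 v : 0 <= dot v v.
Proof. by rewrite /dot mxE sumr_ge0 // => i _; rewrite mxE -expr2 sqr_ge0. Qed.

Lemma dot_eq0 v : dot v v = 0 -> v = 0.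
Proof.
move=> v0; apply/matrixP => i j; rewrite ord1 mxE.
have /(_ i) : forall i, (v^T) 0 i * v i 0 == 0.
  move=> k; have /eqP := v0; rewrite /dot mxE psumr_eq0.
    by move=> /allP/(_ k); rewrite mem_index_enum => /(_ isT).
  by move=> l _; rewrite mxE -expr2 sqr_ge0.
by rewrite mxE mulf_eq0 orbb => /eqP.
Qed.

Lemma posdef1 : posdef (1%:M : 'M[R]_p).
Proof.
move=> v v0; rewrite /sqnorm mul1mx lt_neqAle dot_ge0 andbT eq_sym.
by apply: contra_neq v0; exact: dot_eq0.
Qed.

Lemma posdefD W1 W2 : posdef W1 -> posdef W2 -> posdef (W1 + W2).
Proof.
by move=> p1 p2 v v0; rewrite /sqnorm mulmxDl dotDl addr_gt0 ?p1 ?p2.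
Qed.

(** A nonzero row vector in the left kernel would make the quadratic form vanish at its
    transpose. *)
Lemma posdef_unitmx W : posdef W -> W \in unitmx.
Proof.
move=> pW; rewrite unitmxE unitfE; apply/negP => /det0P[v v0 vW].
have /pW : v^T != 0 by rewrite -(inj_eq (@trmx_inj _ _ _)) trmxK trmx0.
by rewrite /sqnorm dotC /dot trmxK mulmxA vW mul0mx mxE ltxx.
Qed.

Lemma sqnormD W u v : W^T = W ->
  sqnorm W (u + v) = sqnorm W u + sqnorm W v + dot (W *m u) v *+ 2.
Proof.
move=> symW; rewrite /sqnorm mulmxDr !(dotDl, dotDr).
by rewrite [dot (W *m v) u]dotC -[in dot u _]symW -dot_mulmxl; ring.
Qed.

(** Pythagoras: feasible increments differ from [u] by a kernel element, so the cross term vanishes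
    and the excess cost is [sqnorm W (y - (x + u))], which is positive unless [y = x + u]. *)
Lemma argmin_sqnorm m (W : 'M[R]_p) (M : 'M[R]_(m, p)) (b : 'cV[R]_m) x u :
  W^T = W -> posdef W -> M *m u = b ->
  (forall v, M *m v = 0 -> dot (W *m u) v = 0) ->
  argmin [set y | M *m (y - x) = b] (fun y => sqnorm W (y - x)) = [set x + u].
Proof.
move=> symW pW Mu orth.
have xuE : x + u - x = u by rewrite addrC addKr.
have split_sq y : M *m (y - x) = b ->
    sqnorm W (y - x) = sqnorm W u + sqnorm W (y - (x + u)).
  move=> My; have -> : y - x = u + (y - (x + u)) 
    by rewrite opprD addrCA [u + _]addrCA subrr addr0.
  rewrite sqnormD // orth ?mul0rn ?addr0 //.
  by rewrite opprD addrA mulmxBr My Mu subrr.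
apply/seteqP; split => y /=.
  move=> [My /(_ (x + u))]; rewrite /= xuE => /(_ Mu).
  rewrite split_sq // gerDl => le0; apply/eqP; rewrite -subr_eq0.
  by apply/negPn/negP => /pW; rewrite ltNge le0.
move=> ->; split => /=; rewrite xuE // => z Mz; rewrite split_sq // lerDl.
by have [->|/pW/ltW//] := eqVneq (z - (x + u)) 0; rewrite /sqnorm dot0r.
Qed.

End Quadratic.

(** * Block structure of vectors, sketches and metrics *)

Section Blocks.
Context {R : realType} {n d : nat}.
Implicit Types (x u v : 'cV[R]_(pdim n d)).

Lemma wblock_stack w (a : 'I_n -> 'cV[R]_d) : wblock (stack w a) = w.
Proof. by rewrite /wblock mxcolK unlift_none. Qed.

Lemma ablock_stack w (a : 'I_n -> 'cV[R]_d) i : ablock (stack w a) i = a i.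
Proof. by rewrite /ablock mxcolK liftK. Qed.

Lemma eq_blocks u v : wblock u = wblock v ->
  (forall i, ablock u i = ablock v i) -> u = v.
Proof.
move=> uw ua; apply/mxcolP => k.
by case: (unliftP ord0 k) => [i|] ->; [exact: ua | exact: uw].
Qed.

Lemma wblockD u v : wblock (u + v) = wblock u + wblock v.
Proof. exact: submxcolD. Qed.

Lemma ablockD u v i : ablock (u + v) i = ablock u i + ablock v i.
Proof. exact: submxcolD. Qed.

Lemma wblockZ (a : R) u : wblock (a *: u) = a *: wblock u.
Proof. by apply/matrixP => k l; rewrite !mxE. Qed.

Lemma ablockZ (a : R) u i : ablock (a *: u) i = a *: ablock u i.
Proof. by apply/matrixP => k l; rewrite !mxE. Qed.

Lemma dot_blocks u v :
  dot u v = dot (wblock u) (wblock v) + \sum_i dot (ablock u i) (ablock v i).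
Proof.
rewrite -[u in LHS]submxcolK -[v in LHS]submxcolK /dot tr_mxcol.
by rewrite mul_mxrow_mxcol summxE big_ord_recl.
Qed.

(** Sketching reads off one block row, so each constraint becomes an equation in [R^d]. *)
Lemma tr_blockE_mul i m (A : 'M[R]_(pdim n d, m)) :
  (blockE i)^T *m A = submxcol A i.
Proof.
rewrite -[A in LHS]submxcolK /blockE tr_mxcol mul_mxrow_mxcol (bigD1 i) //=.
rewrite eqxx trmx1 mul1mx big1 ?addr0 // => j /negPf ->.
by rewrite trmx0 mul0mx.
Qed.

Variable f : 'I_n -> 'cV[R]_d -> R.

Lemma wblock_san_metric j w u :
  wblock (san_metric f j w *m u) = hess (f j) w *m wblock u.
Proof. by rewrite -[u in LHS]submxcolK mul_mxdiag_mxcol /wblock mxcolK. Qed.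

Lemma ablock_san_metric j w u i :
  ablock (san_metric f j w *m u) i = ablock u i.
Proof.
by rewrite -[u in LHS]submxcolK mul_mxdiag_mxcol /ablock mxcolK mul1mx.
Qed.

Lemma tr_san_metric j w :
  (hess (f j) w)^T = hess (f j) w -> (san_metric f j w)^T = san_metric f j w.
Proof.
move=> symH; rewrite /san_metric tr_mxdiag; apply/eq_mxdiag => k.
by case: ifP => _; rewrite ?symH ?trmx1.
Qed.

(** The form is the Hessian form of the [w] block plus the squared norms of the other blocks; if the
    [w] block is zero, some other block is not. *)
Lemma posdef_san_metric j w :
  posdef (hess (f j) w) -> posdef (san_metric f j w).
Proof.
move=> pH v v0; rewrite /sqnorm dot_blocks wblock_san_metric.
under eq_bigr do rewrite ablock_san_metric.
have [w0|/pH wn0] := eqVneq (wblock v) 0; last first.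
  by rewrite ltr_pwDl // sumr_ge0 // => i _; exact: dot_ge0.
rewrite w0 dot0r add0r lt_neqAle sumr_ge0 ?andbT => [|i _]; last exact: dot_ge0.
apply: contraNneq v0 => /esym/eqP; rewrite psumr_eq0; last first.
  by move=> i _; exact: dot_ge0.
move=> /allP a0.
apply/eqP/eq_blocks => [|i]; first by rewrite w0 /wblock submxcol0.
rewrite [RHS]submxcol0; apply: dot_eq0; apply/eqP.
by apply: (a0 i); rewrite mem_index_enum.
Qed.

End Blocks.

(** * Jacobian of the splitting map *)

Lemma is_derive_comp_linear (R : realType) (V W : normedModType R)
    (L : V -> W) (h : W -> R) (v x : V) (dh : R) :
  linear L -> is_derive (L x) (L v) h dh ->
  is_derive x v (fun y => h (L y)) dh.
Proof.
move=> linL [dhx dhE].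
(* Linearity makes the quotient along [v] literally the quotient of [h] along [L v]. *)
have E : (fun r : R => r^-1 *: (((fun y => h (L y)) \o shift x) (r *: v) - h (L x)))
       = (fun r : R => r^-1 *: ((h \o shift (L x)) (r *: L v) - h (L x))).
  by apply/funext => r /=; rewrite linL.
by split; rewrite /derivable /derive E.
Qed.

Lemma is_derive_linear (R : realType) (V : normedModType R) (c : V -> R) (v x : V) :
  (forall (a : R) u w, c (a *: u + w) = a * c u + c w) ->
  is_derive x v c (c v).
Proof.
by move=> linc; apply: (@is_derive_comp_linear _ _ R^o c id).
Qed.

Section Jacobian.
Context {R : realType} {n d : nat}.
Implicit Types (x v : 'cV[R]_(pdim n d)).

Lemma big_pdim (F : 'I_(pdim n d) -> R) :
  \sum_s F s = \sum_k \sum_q F (tagnat.Rank k q).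
Proof.
rewrite sig_big_dep /= (reindex _ tagnat.sig_bij_on) /=.
apply: eq_bigr => s _.
by rewrite -[in LHS](tagnat.sigK s) /tagnat.Rank; case: (tagnat.sig s).
Qed.

(** Expansion of [v] in the canonical basis; it reassembles a Jacobian-vector product whose
    component is linear. *)
Lemma sum_linear p (c : 'cV[R]_p -> R) (v : 'cV[R]_p) :
  (forall (a : R) u w, c (a *: u + w) = a * c u + c w) ->
  \sum_s c (delta_mx s 0) * v s 0 = c v.
Proof.
move=> linc.
have c0 : c 0 = 0.
  have := linc 1 0 0; rewrite scale1r addr0 mul1r => /eqP.
  by rewrite -subr_eq subrr => /eqP.
have cD u w : c (u + w) = c u + c w by rewrite -[u]scale1r linc mul1r scale1r.
have cZ a u : c (a *: u) = a * c u by rewrite -[a *: u]addr0 linc c0 addr0.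
rewrite [v in RHS]matrix_sum_delta (big_morph c cD c0).
by apply: eq_bigr => s _; rewrite big_ord1 cZ mulrC.
Qed.

Lemma wblock_delta (k : 'I_n.+1) (q : 'I_d) :
  wblock (delta_mx (tagnat.Rank k q) 0 : 'cV[R]_(pdim n d)) =
  if k == ord0 then delta_mx q 0 else 0.
Proof.
apply/matrixP => l j; rewrite ord1 !mxE eqxx andbT -val_eqE tagnat.eq_Rank.
by rewrite eq_sym; case: ifP => _; rewrite !mxE ?eqxx ?andbT.
Qed.

Variable f : 'I_n -> 'cV[R]_d -> R.

Lemma splitting_ord0 x l :
  splitting f x (tagnat.Rank ord0 l) 0 =
  n%:R^-1 * \sum_i x (tagnat.Rank (lift ord0 i) l) 0.
Proof.
transitivity (wblock (splitting f x) l 0); first by rewrite /wblock !mxE.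
by rewrite wblock_stack mxE summxE; congr (_ * _); apply: eq_bigr => i _; rewrite mxE.
Qed.

Lemma splitting_lift x j l :
  splitting f x (tagnat.Rank (lift ord0 j) l) 0 =
  partial l (f j) (wblock x) - x (tagnat.Rank (lift ord0 j) l) 0.
Proof.
transitivity (ablock (splitting f x) j l 0); first by rewrite /ablock !mxE.
by rewrite ablock_stack !mxE.
Qed.

(** The first block of the splitting map is linear, hence its own derivative at every point. *)
Lemma wblock_jacobian x v :
  wblock ((nabla (splitting f) x)^T *m v) = n%:R^-1 *: \sum_i ablock v i.
Proof.
pose c (l : 'I_d) (y : 'cV[R]_(pdim n d)) :=
  n%:R^-1 * \sum_i y (tagnat.Rank (lift ord0 i) l) 0.
have linc l (a : R) u w : c l (a *: u + w) = a * c l u + c l w.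
  rewrite /c mulrCA -mulrDr [a * _]mulr_sumr -big_split /=.
  by congr (_ * _); apply: eq_bigr => i _; rewrite !mxE.
apply/matrixP => l k; rewrite ord1 {k} mxE mxE.
transitivity (c l v); last first.
  by rewrite mxE summxE; congr (_ * _); apply: eq_bigr => i _; rewrite mxE.
rewrite -(sum_linear v (linc l)); apply: eq_bigr => s _; congr (_ * _).
rewrite !mxE /partial.
have -> : (fun y => splitting f y (tagnat.Rank ord0 l) 0) = c l.
  by apply/funext => y; rewrite splitting_ord0.
by case: (is_derive_linear (delta_mx s 0) x (linc l)).
Qed.

(** Component [l] of block [j] is [partial l (f j)] composed with the linear map [wblock], minus a
    coordinate. The transpose arises because entry [(q, l)] of [hess] differentiates [partial l]
    along [q]. *)
Lemma ablock_jacobian x v j : C2 (f j) ->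
  ablock ((nabla (splitting f) x)^T *m v) j =
  (hess (f j) (wblock x))^T *m wblock v - ablock v j.
Proof.
move=> [_ f2].
apply/matrixP => l k; rewrite ord1 {k} mxE mxE.
pose c (y : 'cV[R]_(pdim n d)) := y (tagnat.Rank (lift ord0 j) l) 0.
have linc (a : R) u w : c (a *: u + w) = a * c u + c w by rewrite /c !mxE.
have FE : (fun y => splitting f y (tagnat.Rank (lift ord0 j) l) 0) =
          (fun y => partial l (f j) (wblock y)) - c.
  by apply/funext => y; rewrite splitting_lift.
have linw : linear (wblock : 'cV[R]_(pdim n d) -> 'cV[R]_d).
  by move=> a u w; rewrite wblockD wblockZ.
have dF k q : partial (tagnat.Rank k q)
      (fun y => splitting f y (tagnat.Rank (lift ord0 j) l) 0) x =
    (if k == ord0 then hess (f j) (wblock x) q l else 0)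
    - c (delta_mx (tagnat.Rank k q) 0).
  rewrite FE /partial.
  have hE : is_derive (wblock x) (wblock (delta_mx (tagnat.Rank k q) 0))
      (partial l (f j)) (if k == ord0 then hess (f j) (wblock x) q l else 0).
    (* Basis vectors outside block [ord0] project to the zero direction, along which the derivative
       is zero. *)
    rewrite wblock_delta; case: ifP => _; last exact: is_derive0.
    split; first exact: (f2 l q).1.
    rewrite mxE /partial; set h := (X in _ = 'D_ _ X _).
    by have -> : h = 'D_(delta_mx l 0) (f j) by apply/funext => y; rewrite /h mxE.
  have := is_deriveB (is_derive_comp_linear linw hE)
    (is_derive_linear (delta_mx (tagnat.Rank k q) 0) x linc).
  by case.
under eq_bigr => s _ do rewrite !mxE.
rewrite big_pdim.
under eq_bigr => k _ do under eq_bigr => q _ do rewrite dF mulrBl.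
under eq_bigr => k _ do rewrite sumrB.
rewrite sumrB; rewrite -(big_pdim (fun s => c (delta_mx s 0) * v s 0)).
rewrite (sum_linear v linc) [RHS]mxE; congr (_ + _); last by rewrite !mxE.
rewrite (bigD1 ord0) //= [X in _ + X]big1 => [|i /negPf ->]; last first.
  by rewrite big1 // => q _; rewrite mul0r.
by rewrite addr0 mxE; apply: eq_bigr => q _; rewrite [_^T _ _]mxE [wblock _ _ _]mxE.
Qed.

End Jacobian.

(** * One iteration: SAN increments as constrained minimizers *)

Section Step.
Context {R : realType} {n d : nat} (n_gt0 : (0 < n)%N).
Variables (f : 'I_n -> 'cV[R]_d -> R) (gamma : R).
Hypothesis f_C2 : forall i, C2 (f i).
Hypothesis f_pd : forall i w, posdef (hess (f i) w).
Implicit Types (x u v : 'cV[R]_(pdim n d)).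

(** The increment of a SAN step with [gamma = 1]. *)
Definition san_dir (c : option 'I_n) x : 'cV[R]_(pdim n d) :=
  if c is Some j then
    let dir := - (invmx (1%:M + hess (f j) (wblock x)) *m
                  (grad (f j) (wblock x) - ablock x j)) in
    stack dir (fun i => if i == j then - dir else 0)
  else stack 0 (fun=> - (n%:R^-1 *: \sum_i ablock x i)).

Lemma san_stepE c x : san_step f gamma c x = x + gamma *: san_dir c x.
Proof.
case: c => [j|]; apply: eq_blocks => [|i]; rewrite ?wblockD ?ablockD ?wblockZ ?ablockZ
  ?wblock_stack ?ablock_stack ?scaler0 ?addr0 //.
  by case: eqVneq => [->|_]; rewrite ?scalerN ?scaler0 ?addr0.
by rewrite scalerN scalerA.
Qed.

Lemma argmin_san_sketch c x :
  let: (Sk, Wk) := san_sketch f x c in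
  argmin [set y | Sk^T *m (nabla (splitting f) x)^T *m (y - x)
                  = - (Sk^T *m splitting f x)]
         (fun y => sqnorm Wk (y - x)) = [set x + san_dir c x].
Proof.
case: c => [j|] /=.
- set w := wblock x; set H := hess (f j) w; set r := grad (f j) w - ablock x j.
  have symH : H^T = H by exact: tr_hess.
  have pH1 : posdef (1%:M + H) by exact: posdefD posdef1 (f_pd _ _).
  set dir := - (invmx _ *m _).
  (* This is [(I + H) dir = - r]; as block [j] of the increment is [- dir], it is exactly the
     sketched constraint. *)
  have dirE : H *m dir + dir = - r.
    have unitH := posdef_unitmx pH1.
    by have := mulKVmx unitH (- r); rewrite mulmxN -/dir mulmxDl mul1mx addrC.
  apply: argmin_sqnorm.
  + exact: tr_san_metric.
  + exact: posdef_san_metric.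
  + rewrite -mulmxA !tr_blockE_mul -!/(ablock _ _) ablock_jacobian //.
    by rewrite -/H symH wblock_stack !ablock_stack eqxx opprK dirE.
  (* Kernel vectors satisfy [H v_w = v_j], so the pairing is [dot dir (H v_w) - dot dir v_j = 0],
     once [H] is moved across by symmetry. *)
  + move=> v; rewrite -mulmxA tr_blockE_mul -/(ablock _ _) ablock_jacobian //.
    rewrite -/w -/H symH => /eqP; rewrite subr_eq0 => /eqP Hv.
    rewrite dot_blocks wblock_san_metric wblock_stack -/H dot_mulmxl symH Hv.
    rewrite (bigD1 j) //= ablock_san_metric ablock_stack eqxx (dotNl dir).
    rewrite big1 ?addr0 ?subrr // => i /negPf ij.
    by rewrite ablock_san_metric ablock_stack ij dot0l.
- have n0 : n%:R != 0 :> R by rewrite pnatr_eq0 -lt0n.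
  apply: argmin_sqnorm.
  + exact: trmx1.
  + exact: posdef1.
  (* The average of [n] copies of minus the mean is minus the mean. *)
  + rewrite -mulmxA !tr_blockE_mul -!/(wblock _) wblock_jacobian wblock_stack.
    rewrite (eq_bigr _ (fun i _ => ablock_stack _ _ i)).
    rewrite sumr_const card_ord -scalerMnr scalerMnl.
    by rewrite -(mulr_natr n%:R^-1) mulVf // scale1r.
  (* Kernel vectors have [alpha] blocks of sum zero, hence are orthogonal to an increment with zero
     [w] block and equal [alpha] blocks. *)
  + move=> v; rewrite -mulmxA tr_blockE_mul -/(wblock _) wblock_jacobian => /eqP.
    rewrite scaler_eq0 invr_eq0 (negPf n0) /= => /eqP v0.
    rewrite mul1mx dot_blocks wblock_stack dot0l add0r.
    rewrite (eq_bigr _ (fun i _ => congr1 (fun z => dot z _) (ablock_stack _ _ i))).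
    by rewrite -dot_sumr v0 dot0r.
Qed.

Lemma vmsnr_step_san c x x' :
  vmsnr_step (splitting f) gamma (san_sketch f x c) x x' <->
  x' = san_step f gamma c x.
Proof.
have stepE : (1 - gamma) *: x + gamma *: (x + san_dir c x) = san_step f gamma c x.
  by rewrite san_stepE scalerBl scale1r scalerDr addrA subrK.
have := argmin_san_sketch c x; rewrite /vmsnr_step.
case: (san_sketch f x c) => Sk Wk ->; split.
  move=> [y [Ey ->]]; have : [set y] (x + san_dir c x) by rewrite -Ey.
  by move=> /= <-.
by move=> ->; exists (x + san_dir c x).
Qed.

Lemma vmsnr_run_san x0 (c : nat -> option 'I_n) (X : nat -> 'cV[R]_(pdim n d)) :
  vmsnr_run (splitting f) gamma x0 X (fun k => san_sketch f (X k) (c k)) <->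
  (forall k, X k = san f gamma x0 c k).
Proof.
split=> [[X0 XS]|XE].
  by elim=> // k IHk; have /vmsnr_step_san := XS k; rewrite IHk.
by split=> [|k]; [rewrite XE | apply/vmsnr_step_san; rewrite !XE].
Qed.

End Step.

(** * Finite histories of independent choices *)

Lemma big_option (R : nmodType) (I : finType) (F : option I -> R) :
  \sum_c F c = F None + \sum_i F (Some i).
Proof.
rewrite (bigD1 None) //=; congr (_ + _).
rewrite (reindex_omap Some id) => [|[i|]] //.
by apply: eq_bigl => i; rewrite /= eqxx.
Qed.

(** Makes a finite history a total sequence, as [san] expects; [e] serves either as the choice at
    step [k] or as mere padding. *)
Definition extend_ord (I : Type) (k : nat) (c : 'I_k -> I) (e : I) (i : nat) : I :=
  if insub i is Some j then c j else e.

Lemma extend_ordE (I : Type) (k : nat) (c : 'I_k -> I) e (j : 'I_k) :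
  extend_ord c e j = c j.
Proof. by rewrite /extend_ord valK. Qed.

Lemma extend_ord_last (I : Type) (k : nat) (c : 'I_k -> I) e :
  extend_ord c e k = e.
Proof. by rewrite /extend_ord insubF ?ltnn. Qed.

Section Choices.
Context {R : realType} {n : nat} (pi : R).
Context {dT : measure_display} {T : measurableType dT} (P : probability T R).
Variable xi : nat -> T -> option 'I_n.
Hypothesis xi_iid : san_choices pi P xi.

Definition history k (t : T) : {ffun 'I_k -> option 'I_n} := [ffun i : 'I_k => xi i t].

Definition cylinder k (p : {ffun 'I_k -> option 'I_n} * option 'I_n) : set T :=
  [set t | history k t = p.1 /\ xi k t = p.2].

(** Gives cylinders the shape used by the independence hypothesis: an intersection over a
    duplicate-free list. *)
Lemma cylinderE k (p : {ffun 'I_k -> option 'I_n} * option 'I_n) :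
  cylinder p = \bigcap_(i in [set` iota 0 k.+1]) (xi i @^-1` [set extend_ord p.1 p.2 i]).
Proof.
case: p => c e.
have memk i : (i \in iota 0 k.+1) = (i < k.+1)%N by rewrite mem_iota.
have inP i : (i < k.+1)%N -> [set` iota 0 k.+1] i by rewrite -memk.
apply/seteqP; split => t.
  move=> [/= hc he] i ik; have : (i < k.+1)%N by rewrite -memk.
  rewrite ltnS leq_eqVlt => /orP[/eqP ->|{}ik]; first by rewrite /= extend_ord_last.
  by rewrite /= (extend_ordE c e (Ordinal ik)) -hc ffunE.
move=> H; split => /=.
  apply/ffunP => i; rewrite ffunE -(extend_ordE c e i).
  by apply/H/inP; rewrite ltnS ltnW.
by rewrite -(extend_ord_last c e); apply/H/inP.
Qed.

Lemma measurable_cylinder k (p : {ffun 'I_k -> option 'I_n} * option 'I_n) :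
  measurable (cylinder p).
Proof.
by rewrite cylinderE; apply: fin_bigcap_measurable => // i _; exact: xi_iid.1.
Qed.

Lemma probability_cylinder k (p : {ffun 'I_k -> option 'I_n} * option 'I_n) :
  P (cylinder p) = ((\prod_(i < k) choice_prob pi (p.1 i)) * choice_prob pi p.2)%:E.
Proof.
rewrite cylinderE xi_iid.2 ?iota_uniq // -[iota _ _]/(index_iota 0 k.+1).
rewrite big_nat_recr //= extend_ord_last big_mkord; congr ((_ * _)%:E).
by apply: eq_bigr => i _; rewrite extend_ordE.
Qed.

Lemma history_choice_bigcup k (B : pred {ffun 'I_k -> option 'I_n})
    (C : pred (option 'I_n)) :
  [set t | B (history k t) /\ C (xi k t)] =
  \bigcup_(p in [set` [pred p | B p.1 && C p.2]]) @cylinder k p.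
Proof.
apply/seteqP; split => t /=.
  by move=> [Bt Ct]; exists (history k t, xi k t); rewrite //= inE /= Bt.
by move=> [p]; rewrite /= inE /= => /andP[Bp Cp] [-> ->].
Qed.

Lemma measurable_history_choice k (B : pred {ffun 'I_k -> option 'I_n})
    (C : pred (option 'I_n)) :
  measurable [set t | B (history k t) /\ C (xi k t)].
Proof.
rewrite history_choice_bigcup; apply: fin_bigcup_measurable => [|p _].
  exact: finite_finset.
exact: measurable_cylinder.
Qed.

(** Cylinder weights are products, so their sum over the rectangle of [B] and [C] factors: the next
    choice is independent of the past. *)
Lemma probability_history_choice k (B : pred {ffun 'I_k -> option 'I_n})
    (C : pred (option 'I_n)) :
  P [set t | B (history k t) /\ C (xi k t)] =
  ((\sum_(c | B c) \prod_(i < k) choice_prob pi (c i))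
   * \sum_(e | C e) choice_prob pi e)%:E.
Proof.
rewrite history_choice_bigcup measure_fin_bigcup; last first.
- by move=> p _; exact: measurable_cylinder.
- by move=> [c e] [c' e'] _ _ [t []]; rewrite /cylinder /= => -[<- <-] [<- <-].
- exact: finite_finset.
rewrite -(bigfs _ (index_enum_uniq _)) => [|p _]; last by rewrite mem_index_enum.
rewrite big_distrlr /= pair_big /= -sumEFin.
by apply: eq_bigr => p _; rewrite probability_cylinder.
Qed.

End Choices.

(** * Conditional law of the sketches *)

Lemma sum_choice_prob (R : realType) (n : nat) (pi : R) : (0 < n)%N ->
  \sum_(e : option 'I_n) choice_prob pi e = 1.
Proof.
move=> n_gt0; rewrite big_option /= sumr_const card_ord -(mulr_natr (_ * _)).
by rewrite mulfVK ?pnatr_eq0 -?lt0n // addrC subrK.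
Qed.

(** Exhibits [D_SAN] as the image of the choice law under [san_sketch f x]. *)
Lemma D_SANE (R : realType) (n d : nat) (pi : R) (f : 'I_n -> 'cV[R]_d -> R) x A :
  D_SAN pi f x A = \sum_(e | `[< A (san_sketch f x e) >]) choice_prob pi e.
Proof.
rewrite big_mkcond big_option /D_SAN 2!mulr_sumr.
have termE e z : z * \1_A (san_sketch f x e) =
    if `[< A (san_sketch f x e) >] then z else 0.
  by rewrite indicE /in_mem /= /in_set; case: asbool; rewrite ?mulr1 ?mulr0.
by rewrite termE; congr (_ + _); apply: eq_bigr => j _; rewrite mulrA termE.
Qed.

(** Adaptedness of the iterates, which allows a padded finite history to replace the infinite
    sequence of choices. *)
Lemma san_eq (R : realType) (n d : nat) (f : 'I_n -> 'cV[R]_d -> R) (gamma : R)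
    x0 (c c' : nat -> option 'I_n) k :
  (forall i, (i < k)%N -> c i = c' i) -> san f gamma x0 c k = san f gamma x0 c' k.
Proof.
elim: k => //= k IHk cc'; rewrite cc' // IHk // => i ik.
by apply: cc'; exact: ltnW.
Qed.

Lemma san_sampled (R : realType) (n d : nat) (n_gt0 : (0 < n)%N)
    (f : 'I_n -> 'cV[R]_d -> R) (pi gamma : R)
    (dT : measure_display) (T : measurableType dT) (P : probability T R)
    (xi : nat -> T -> option 'I_n) (x0 : 'cV[R]_(pdim n d)) :
  san_choices pi P xi ->
  let X := fun k t => san f gamma x0 (fun i => xi i t) k in
  sampled_from P (D_SAN pi f) X (fun k t => san_sketch f (X k t) (xi k t)).
Proof.
move=> xi_iid X k x s A H.
(* The padding [None] is never read: iterates up to index [k] use only choices before [k]. *)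
pose Xc (c : {ffun 'I_k -> option 'I_n}) := san f gamma x0 (extend_ord c None).
pose B : pred {ffun 'I_k -> option 'I_n} := fun c =>
  `[< (forall i, (i <= k)%N -> Xc c i = x i) /\
      (forall i, (i < k)%N -> san_sketch f (Xc c i) (extend_ord c None i) = s i) >].
pose C : pred (option 'I_n) := fun e => `[< A (san_sketch f (x k) e) >].
have xiE t i : (i < k)%N -> extend_ord (history xi k t) None i = xi i t.
  by move=> ik; rewrite (extend_ordE _ _ (Ordinal ik)) ffunE.
have XE t i : (i <= k)%N -> Xc (history xi k t) i = X i t.
  by move=> ik; apply: san_eq => j ji; rewrite xiE // (leq_trans ji).
have HB t : H t <-> B (history xi k t).
  rewrite /H /B; split.
    move=> [hX hS]; apply/asboolP; split => i ik; first by rewrite XE // hX.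
    by rewrite XE ?(ltnW ik) // xiE // hS.
  move=> /asboolP[hX hS]; split => i ik; first by rewrite -XE // hX.
  by rewrite -XE ?(ltnW ik) // -(xiE t) // hS.
(* The trivial condition on the next choice puts [P H] under the same product formula, with second
   factor 1. *)
have HE : H = [set t | B (history xi k t) /\ predT (xi k t)].
  by apply/seteqP; split => t; rewrite /= -HB //; case.
(* On [H] the iterate [X k] has the prescribed value [x k], so membership in [A] depends on the
   choice at step [k] alone. *)
have HAE : H `&` (fun t => san_sketch f (X k t) (xi k t)) @^-1` A =
           [set t | B (history xi k t) /\ C (xi k t)].
  apply/seteqP; split => t /=; rewrite -HB => -[Ht]; split => //.
    by apply/asboolP; rewrite -(Ht.1 k).
  by rewrite (Ht.1 k) //; apply/asboolP.
split.
- by rewrite HE; exact: (measurable_history_choice xi_iid).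
- by rewrite HAE; exact: (measurable_history_choice xi_iid).
- rewrite HAE HE !(probability_history_choice xi_iid) sum_choice_prob // mulr1.
  by rewrite D_SANE EFinM.
Qed.

Unset Implicit Arguments.

Theorem lemmaD2 (R : realType) (n d : nat) (n_gt0 : (0 < n)%N)
    (f : 'I_n -> 'cV[R]_d -> R)
    (f_C2 : forall i, C2 (f i))
    (f_pd : forall i w, posdef (hess (f i) w))
    (pi gamma : R) (pi01 : 0 < pi < 1) (gamma01 : 0 < gamma <= 1)
    (dT : measure_display) (T : measurableType dT) (P : probability T R)
    (xi : nat -> T -> option 'I_n) (xi_iid : san_choices pi P xi)
    (x0 : 'cV[R]_(pdim n d)) :
  (forall (t : T) (X : nat -> 'cV[R]_(pdim n d)),
     vmsnr_run (splitting f) gamma x0 X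
               (fun k => san_sketch f (X k) (xi k t))
     <-> (forall k, X k = san f gamma x0 (fun i => xi i t) k))
  /\ (let X := fun k t => san f gamma x0 (fun i => xi i t) k in
      sampled_from P (D_SAN pi f) X (fun k t => san_sketch f (X k t) (xi k t))).
Proof.
split=> [t X|]; first exact: vmsnr_run_san.
exact: san_sampled.
Qed.
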